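(* Assume that $H\cap C\neq\emptyset$; that $\Delta_N\subset\Delta_{N+1}$ for all $N$; that $\{x_1,\dots,x_n\}\subset\Delta_N$ for all $N$; that $\pi_N(C)\subset C$ for all $N$; and that the matrix $\Gamma_N=(K(t_i,t_j))_{0\le i,j\le N}$ is invertible for all $N$. Let $\widehat u$ be the unique minimizer of $J$ over $H\cap C$ and let $\widehat u_N$ be the unique minimizer of $J_N$ over $C_N=H_N\cap C$. Then $$\widehat u_N\longrightarrow \widehat u\quad\text{in } E \text{ as } N\to+\infty,$$ that is, $\sup_{x\in[0,1]}|\widehat u_N(x)-\widehat u(x)|\to 0$.
   Context: $E=C([0,1],\mathbb R)$ is equipped with the supremum norm $\|\cdot\|_E$. $H\subset E$ is a reproducing kernel Hilbert space (RKHS) of functions on $[0,1]$ with symmetric positive definite kernel $K$, with $\sup_{x\in[0,1]}K(x,x)<+\infty$. $C\subset E$ is a closed convex subset of $E$. Data $(x_i,y_i)\in[0,1]\times\mathbb R$, $1\le i\le n$, and $\sigma>0$ are given. For $u\in H$, $J(u)=\|u\|_H^2+\frac1{\sigma^2}\sum_{i=1}^n(u(x_i)-y_i)^2$. When $H\cap C\ne\emptyset$, $J$ has a unique minimizer over $H\cap C$. For each $N$, $\Delta_N: 0=t_0<t_1<\dots<t_N=1$ is a subdivision of $[0,1]$ (nodes depend on $N$; $\Delta_N$ also denotes its set of nodes) with mesh $\delta_N=\max_i|t_{i+1}-t_i|\to0$ as $N\to\infty$. $H_N\subset E$ is the space of continuous piecewise linear functions associated with $\Delta_N$, with basis of hat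 functions $\varphi_0,\dots,\varphi_N$ ($\varphi_j(t_i)=\delta_{ij}$). $\pi_N:E\to H_N$ is the interpolation $\pi_N(f)=\sum_{j=0}^N f(t_j)\varphi_j$. For $f\in E$, $c_f=(f(t_0),\dots,f(t_N))^\top$. With $\Gamma_N$ invertible, $H_N$ carries the inner product $(u_N,v_N)_{H_N}=c_{u_N}^\top\Gamma_N^{-1}c_{v_N}$ and the induced norm $\|\cdot\|_{H_N}$. For $v_N\in H_N$, $J_N(v_N)=\|v_N\|_{H_N}^2+\frac1{\sigma^2}\sum_{i=1}^n(v_N(x_i)-y_i)^2$. Under the stated assumptions $J_N$ has a unique minimizer over $C_N$. *)

(* Defs.v *)
From HB Require Import structures.
From mathcomp Require Import all_boot all_order all_algebra.
From mathcomp Require Import all_classical all_reals all_analysis.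

Set Implicit Arguments.
Unset Strict Implicit.
Unset Printing Implicit Defensive.

Import Order.TTheory GRing.Theory Num.Theory.
Import numFieldNormedType.Exports.

Local Open Scope classical_set_scope.
Local Open Scope ring_scope.

(* [0, 1] is a subtype rather than a subset of R, so that Leibniz equality of
   functions on it is equality on [0, 1], with no junk values outside. *)
Definition unit_itv (R : realType) : set R := `[0, 1]%classic.
Notation I01 R := (set_type (@unit_itv R)).

(* E = C([0, 1], R), to be normed by the supremum. [continuousType (I01 R) R]
   is not reused: it comes with the compact-open topology and without a normed
   module structure. *)

Definition continuous_pred (R : realType) : {pred I01 R -> R} :=
  mem [set f : I01 R -> R | continuous f].

Lemma continuous_predP (R : realType) (f : I01 R -> R) :
  f \in @continuous_pred R <-> continuous f.
Proof. by rewrite /continuous_pred inE. Qed.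

Record contI (R : realType) := ContI {
  contI_fun :> I01 R -> R;
  _ : contI_fun \in @continuous_pred R }.

HB.instance Definition _ (R : realType) := [isSub for @contI_fun R].
HB.instance Definition _ (R : realType) := [Choice of contI R by <:].

Section contI_normed_module.
Variable R : realType.
Implicit Types f g : contI R.

Lemma continuous_pred_submod : submod_closed (@continuous_pred R).
Proof.
split=> [|a f g /continuous_predP cf /continuous_predP cg].
  by apply/continuous_predP; exact: (@cst_continuous _ _ (0 : R)).
apply/continuous_predP => x.
have caf : a * f z @[z --> x] --> a * f x.
  exact: (@cvgM _ _ _ _ (fun=> a) f _ _ (@cvg_cst _ _ _ _ _) (cf x)).
exact: (@cvgD _ _ _ _ _ (fun z => a * f z) g _ _ caf (cg x)).
Qed.

HB.instance Definition _ :=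
  GRing.isSubmodClosed.Build R (I01 R -> R) (@continuous_pred R)
    continuous_pred_submod.
HB.instance Definition _ := [SubChoice_isSubLmodule of contI R by <:].

Lemma contI_continuous f : continuous f.
Proof. exact/continuous_predP/(valP f). Qed.

Lemma contIP f g : f = g <-> f =1 g.
Proof. by split=> [->//|fg]; apply/val_inj/funext. Qed.

Lemma contIDE f g x : (f + g) x = f x + g x. Proof. by []. Qed.

Lemma contINE f x : (- f) x = - f x. Proof. by []. Qed.

Lemma contIZE (a : R) f x : (a *: f) x = a * f x. Proof. by []. Qed.

Definition sup_norm f : R := sup (range (fun x : I01 R => `|f x|)).

Lemma I01_0_subproof : (0 : R) \in @unit_itv R.
Proof. by rewrite /unit_itv inE /= in_itv /= lexx ler01. Qed.

Definition I01_0 : I01 R := exist _ 0 I01_0_subproof.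

Lemma sup_norm_has_sup f : has_sup (range (fun x : I01 R => `|f x|)).
Proof.
split; first by exists `|f I01_0|; exists I01_0.
have cvf : {within @unit_itv R, continuous (valL f)}.
  by apply/subspace_valL_continuousP => x; exact: contI_continuous.
have [M [_ Mf]] :=
  compact_bounded (continuous_compact cvf (@segment_compact R 0 1)).
exists (M + 1) => _ [x _ <-]; apply: (Mf (M + 1)); first by rewrite ltrDl.
exists (\val x); first exact: set_valP.
by have /(congr1 (fun h => h x)) := @valLK _ _ (point : R) (@unit_itv R) f.
Qed.

Lemma sup_norm_ge f x : `|f x| <= sup_norm f.
Proof.
by apply: ub_le_sup; [case: (sup_norm_has_sup f)|exists x].
Qed.

Lemma sup_norm_le f (M : R) : (forall x, `|f x| <= M) -> sup_norm f <= M.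
Proof.
move=> fM; apply: ge_sup; first by case: (sup_norm_has_sup f).
by move=> _ [x _ <-].
Qed.

Lemma sup_normD f g : sup_norm (f + g) <= sup_norm f + sup_norm g.
Proof.
apply: sup_norm_le => x; rewrite contIDE (le_trans (ler_normD _ _))//.
by rewrite lerD// sup_norm_ge.
Qed.

Lemma sup_normZ (a : R) f : sup_norm (a *: f) = `|a| * sup_norm f.
Proof.
apply/eqP; rewrite eq_le; apply/andP; split.
  by apply: sup_norm_le => x; rewrite contIZE normrM ler_wpM2l// sup_norm_ge.
have [->|a0] := eqVneq a 0.
  by rewrite normr0 mul0r (le_trans _ (sup_norm_ge _ I01_0)).
rewrite mulrC -ler_pdivlMr ?normr_gt0//; apply: sup_norm_le => x.
by rewrite ler_pdivlMr ?normr_gt0// mulrC -normrM -contIZE sup_norm_ge.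
Qed.

Lemma sup_norm0_eq0 f : sup_norm f = 0 -> f = 0.
Proof.
move=> f0; apply/contIP => x; apply/eqP.
by rewrite -normr_le0 -f0 sup_norm_ge.
Qed.

HB.instance Definition _ := @Lmodule_isNormed.Build R (contI R)
  sup_norm sup_normD sup_normZ sup_norm0_eq0.

End contI_normed_module.

(* Below, [dot] is total on E but only its values on [H] are constrained. *)

Section rkhs.
Variable R : realType.
Implicit Types (H : set (contI R)) (dot : contI R -> contI R -> R).
Implicit Type K : I01 R -> I01 R -> R.

Definition dot_norm dot (u : contI R) : R := Num.sqrt (dot u u).

Record is_hilbert_subspace H dot : Prop := IsHilbertSubspace {
  hilbert0 : H 0;
  hilbert_linear : forall (a : R) u v, H u -> H v -> H (a *: u + v);
  hilbert_dotC : forall u v, H u -> H v -> dot u v = dot v u;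
  hilbert_dotDl : forall (a : R) u v w, H u -> H v -> H w ->
    dot (a *: u + v) w = a * dot u w + dot v w;
  hilbert_dot_ge0 : forall u, H u -> 0 <= dot u u;
  hilbert_dot_eq0 : forall u, H u -> dot u u = 0 -> u = 0;
  hilbert_complete : forall u_ : nat -> contI R, (forall k, H (u_ k)) ->
    (forall e : R, 0 < e -> exists k0 : nat, forall p q : nat,
       (k0 <= p)%N -> (k0 <= q)%N -> dot_norm dot (u_ p - u_ q) < e) ->
    exists2 u, H u & dot_norm dot (u_ k - u) @[k --> \oo] --> (0 : R) }.

Definition is_reproducing_kernel H dot K : Prop :=
  forall x : I01 R, exists k : contI R,
    [/\ H k, forall z, k z = K z x & forall u, H u -> u x = dot u k].

Definition is_rkhs H dot K : Prop :=
  is_hilbert_subspace H dot /\ is_reproducing_kernel H dot K.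

(* "Positive definite" in the sense usual for kernels: the quadratic forms are
   nonnegative, possibly degenerate. *)
Definition is_spd_kernel K : Prop :=
  (forall x z, K x z = K z x) /\
  forall (m : nat) (z : 'I_m -> I01 R) (c : 'I_m -> R),
    0 <= \sum_(i < m) \sum_(j < m) c i * c j * K (z i) (z j).

End rkhs.

Section piecewise_linear.
Variables (R : realType) (N : nat) (t : 'I_N.+1 -> I01 R).

(* The end points t_i and t_{i+1} of the i-th subinterval, for i < N. *)
Definition node_lo (i : 'I_N) : R := \val (t (widen_ord (leqnSn N) i)).
Definition node_hi (i : 'I_N) : R := \val (t (lift ord0 i)).

Definition is_subdivision : Prop :=
  [/\ \val (t ord0) = 0 :> R, \val (t ord_max) = 1 :> R
    & forall i : 'I_N, node_lo i < node_hi i].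

Definition mesh : R := \big[Num.max/0]_(i < N) `|node_hi i - node_lo i|.

Definition pl_space : set (contI R) :=
  [set v | forall i : 'I_N, exists a b : R, forall x : I01 R,
     node_lo i <= \val x <= node_hi i -> v x = a * \val x + b].

(* The hat function at t_j is the positive part of the minimum of the line
   rising from 0 at t_{j-1} to 1 at t_j and of the line falling from 1 at t_j
   to 0 at t_{j+1}; at the end points of [0, 1] the line that would use a
   missing neighbour is replaced by the constant 1. *)
Definition hat_rise (j : 'I_N.+1) (x : R) : R :=
  if j == ord0 then 1
  else let s := \val (t (inord j.-1)) in (x - s) / (\val (t j) - s).

Definition hat_fall (j : 'I_N.+1) (x : R) : R :=
  if j == ord_max then 1
  else let s := \val (t (inord j.+1)) in (s - x) / (s - \val (t j)).

Definition hat_fun (j : 'I_N.+1) (x : I01 R) : R :=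
  Num.max 0 (Num.min (hat_rise j (\val x)) (hat_fall j (\val x))).

Lemma hat_fun_subproof j : hat_fun j \in @continuous_pred R.
Proof.
have H (x : I01 R) : hat_fun j z @[z --> x] --> hat_fun j x.
  have FF : Filter (nbhs x) := @nbhs_filter (I01 R) x.
  have cval : (\val z : R) @[z --> x] --> (\val x : R).
    exact: (@initial_continuous (I01 R) R set_val).
  have cc (a : R) : cst a z @[z --> x] --> a by apply: cvg_cst.
  have crise : hat_rise j (\val z) @[z --> x] --> hat_rise j (\val x).
    rewrite /hat_rise; case: ifP => _; first exact: cc.
    by apply: cvgM; [apply: cvgB => //; apply: cc|apply: cc].
  have cfall : hat_fall j (\val z) @[z --> x] --> hat_fall j (\val x).
    rewrite /hat_fall; case: ifP => _; first exact: cc.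
    by apply: cvgM; [apply: cvgB => //; apply: cc|apply: cc].
  exact: (continuous_max (cc 0) (continuous_min crise cfall)).
by apply/continuous_predP => x; exact: H.
Qed.

Definition hat (j : 'I_N.+1) : contI R := ContI (hat_fun_subproof j).

Definition pl_interp (f : contI R) : contI R :=
  \sum_(j < N.+1) f (t j) *: hat j.

Definition gram_mx (K : I01 R -> I01 R -> R) : 'M[R]_N.+1 :=
  \matrix_(i, j) K (t i) (t j).

Definition node_values (f : contI R) : 'cV[R]_N.+1 := \col_i f (t i).

(* The inner product of the piecewise linear space; meaningful as such when the
   Gram matrix is invertible. *)
Definition pl_dot (K : I01 R -> I01 R -> R) (u v : contI R) : R :=
  ((node_values u)^T *m invmx (gram_mx K) *m node_values v) 0 0.

End piecewise_linear.

(** The penalized least squares functional attached to an inner product: J for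
    the one of the RKHS, J_N for [pl_dot (t N) K]. *)

Definition smoothing_objective (R : realType)
    (dot : contI R -> contI R -> R) (n : nat) (x : 'I_n -> I01 R)
    (y : 'I_n -> R) (sigma : R) (u : contI R) : R :=
  dot_norm dot u ^+ 2 + (sigma ^+ 2)^-1 * \sum_(i < n) (u (x i) - y i) ^+ 2.

Definition is_minimizer (R : realType) (T : Type) (F : T -> R) (A : set T)
    (u : T) : Prop :=
  A u /\ forall v, A v -> F u <= F v.

(* Main.v *)
Require Import Defs.
From mathcomp Require Import all_boot all_order all_algebra.
From mathcomp Require Import all_classical all_reals all_analysis.
From mathcomp Require Import ring lra.
Import Order.TTheory GRing.Theory Num.Theory.
Import numFieldNormedType.Exports.

Set Implicit Arguments.
Unset Strict Implicit.
Unset Printing Implicit Defensive.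

Local Open Scope classical_set_scope.
Local Open Scope ring_scope.

(** Write pi_N for piecewise linear interpolation at the nodes of the N-th
    subdivision, and I_N f for the kernel interpolant of f: the combination of
    the functions K(., t_j) that agrees with f at the nodes. Three facts
    transfer the discrete problems to H. The norm of the piecewise linear space
    is the H-norm read through I_N ([dot_norm_kernel_interp]). The function
    I_N u has the least H-norm among the elements of H that agree with u at the
    nodes ([kernel_interp_min]). The data points are nodes, so the data term is
    the same for u and I_N u.

    Put h_N = I_N uhat_N, so that pi_N h_N = uhat_N. By these facts h_N
    minimizes J over the set A_N of the u in H with pi_N u in C. Since
    pi_N (C) is included in C, each A_N contains H `&` C; since the subdivisions
    are nested, the convex sets A_N decrease. Hence J (h_N) is nondecreasing
    and bounded by J uhat. As J is strongly convex,
    ||h_N - h_M||^2 <= 2 (J h_M - J h_N) for N <= M, so that (h_N) is a Cauchy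
    sequence for the norm of H ([nested_minimizers_cvg]). Let u be its limit. It
    is also the limit in E, as the kernel is bounded ([rkhs_norm_le]). For every
    N, pi_N u is the limit of pi_N h_M as M grows, hence lies in the closed set
    C; and pi_N u tends to u as the mesh tends to 0 ([pl_interp_cvg]), so u is
    in C. Now J u = lim J h_N <= J uhat gives u = uhat by strong convexity.

    Finally pi_N does not increase the sup norm ([pl_interp_norm]), so
    uhat_N = pi_N (h_N - uhat) + pi_N uhat tends to uhat in E. *)

(** * Continuous functions on the unit interval *)

Section continuous_functions.
Variable R : realType.
Implicit Types f g : contI R.

Lemma contI_sumE (I : Type) (r : seq I) (F : I -> contI R) (x : I01 R) :
  (\sum_(i <- r) F i) x = \sum_(i <- r) F i x.
Proof. exact: (big_morph (fun f : contI R => f x)). Qed.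

Lemma contI_norm_ge f (x : I01 R) : `|f x| <= `|f|.
Proof. exact: sup_norm_ge. Qed.

Lemma contI_norm_le f (e : R) : (forall x, `|f x| <= e) -> `|f| <= e.
Proof. exact: sup_norm_le. Qed.

Lemma I01_bounds (x : I01 R) : 0 <= (\val x : R) <= 1.
Proof. by have := set_valP x; rewrite /unit_itv /= in_itv. Qed.

Lemma contI_cvg_eval (u_ : nat -> contI R) (u : contI R) (x : I01 R) :
  u_ @ \oo --> u -> u_ k x @[k --> \oo] --> u x.
Proof.
move=> u_u; apply/cvgrPdist_lt => e e0.
near=> k; rewrite -[u x - _]/((u - u_ k) x) (le_lt_trans (contI_norm_ge _ _))//.
by near: k; exact: cvgr_dist_lt.
Unshelve. all: by end_near. Qed.

(** Heine's theorem, by the near-covering form of compactness of [0, 1]: around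
    each a some modulus d works for all points near a. *)
Lemma contI_uniformly_continuous f (e : R) : 0 < e ->
  exists2 d : R, 0 < d &
    forall x z : I01 R, `|\val x - \val z : R| < d -> `|f x - f z| < e.
Proof.
move=> e0.
have cvf : {within @unit_itv R, continuous (valL f)}.
  by apply/subspace_valL_continuousP => x; exact: contI_continuous.
have valLE (x : I01 R) : valL f (\val x) = f x.
  by have /(congr1 (fun h => h x)) := @valLK _ _ (point : R) (@unit_itv R) f.
have /compact_near_coveringP cov := @segment_compact R 0 1.
pose P (d a : R) := @unit_itv R a -> forall b : R, @unit_itv R b ->
  `|a - b| < d -> `|valL f a - valL f b| < e.
have /cov cover : forall a : R, `[0, 1]%classic a ->
    \forall a' \near a & d \near 0^'+, P d a'.
  move=> a Ia.
  have /subspace_continuousP/(_ a Ia)/cvgr_dist_lt := cvf.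
  have e20 : 0 < e / 2 by rewrite divr_gt0.
  move=> /(_ _ e20); rewrite near_withinE => /nbhs_ballP[r /= r0 ar].
  have fa (c : R) : `|a - c| < r -> unit_itv c ->
      `|valL f a - valL f c| < e / 2.
    by move=> ac; apply: ar.
  near=> a' d => /= Ia' b Ib a'b.
  have a'r : `|a - a'| < r / 2.
    near: a'; apply: cvgr_dist_lt; first exact: cvg_id.
    by rewrite divr_gt0.
  have dr : d < r / 2 by near: d; apply: nbhs_right_lt; rewrite divr_gt0.
  have fa' := fa a' ltac:(lra) Ia'.
  have fb : `|valL f a - valL f b| < e / 2.
    apply: fa => //; rewrite -(subrKA a') (le_lt_trans (ler_normD _ _))//; lra.
  rewrite -(subrKA (valL f a)) (le_lt_trans (ler_normD _ _))// distrC; lra.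
near (0 : R)^'+ => d.
have Pd : `[0, 1] `<=` P d by near: d.
exists d => // x z xz; rewrite -!valLE.
by apply: Pd => //; exact: set_valP.
Unshelve. all: by end_near. Qed.

End continuous_functions.

(** * Piecewise linear interpolation *)

Lemma norm_convex_comb_le (R : realDomainType) (p q r s e : R) :
  0 <= r -> 0 <= s -> r + s = 1 -> `|p| <= e -> `|q| <= e ->
  `|p * r + q * s| <= e.
Proof.
move=> r0 s0 rs pe qe; rewrite (le_trans (ler_normD _ _))// !normrM.
rewrite (ger0_norm r0) (ger0_norm s0) -[leRHS]mulr1 -rs mulrDr.
by rewrite lerD// ler_wpM2r.
Qed.

Section interpolation.
Variables (R : realType) (N : nat) (t : 'I_N.+1 -> I01 R).
Hypothesis t_sub : is_subdivision t.
Implicit Types f g v : contI R.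

Local Notation lo i := (widen_ord (leqnSn N) i).
Local Notation hi i := (lift ord0 i).
(** [node] indexes the nodes by [nat], out of reach of the dependent arithmetic
    of ordinals; [inord] is only meaningful for indices at most [N]. *)
Local Notation node k := (\val (t (inord k)) : R).

Lemma nodeE (j : 'I_N.+1) (k : nat) : j = k :> nat -> (\val (t j) : R) = node k.
Proof. by move=> <-; rewrite inord_val. Qed.

Lemma node_loE (i : 'I_N) : node_lo t i = node i. Proof. exact: nodeE. Qed.

Lemma node_hiE (i : 'I_N) : node_hi t i = node i.+1. Proof. exact: nodeE. Qed.

Lemma node_lt (j k : nat) : (j < k <= N)%N -> node j < node k.
Proof.
have [_ _ lohi] := t_sub.
elim: k => [//|k IHk] /andP[jk kN].
have node_k : node k < node k.+1.
  by have := lohi (Ordinal kN); rewrite node_loE node_hiE.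
move: jk; rewrite ltnS leq_eqVlt => /predU1P[->//|jk].
by apply: lt_trans node_k; apply: IHk; rewrite jk ltnW.
Qed.

Lemma node_le (j k : nat) : (j <= k <= N)%N -> node j <= node k.
Proof.
move=> /andP[]; rewrite leq_eqVlt => /predU1P[->//|jk kN].
by apply/ltW/node_lt; rewrite jk.
Qed.

(** The cell of x ends at the first node, other than the node 0, that is not to
    the left of x. *)
Lemma cell_exists (x : I01 R) :
  exists i : 'I_N, node_lo t i <= (\val x : R) <= node_hi t i.
Proof.
have [t0 t1 _] := t_sub; have /andP[x0 x1] := I01_bounds x.
have node0 : node 0 = 0 by rewrite -t0 -(@nodeE ord0).
have nodeN : node N = 1 by rewrite -t1 -(@nodeE ord_max).
have N0 : (0 < N)%N.
  case: (posnP N) => // N0.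
  suff : (0 : R) = 1 by move=> /eqP; rewrite eq_sym oner_eq0.
  by rewrite -t0 -t1; congr (\val (t _)); apply: val_inj; rewrite /= N0.
have ex_k : exists k, (0 < k)%N && ((\val x : R) <= node k).
  by exists N; rewrite N0 nodeN.
case: (ex_minnP ex_k) => -[//|k] /= xk kmin.
have kN : (k < N)%N by apply: kmin; rewrite N0 nodeN.
exists (Ordinal kN); rewrite node_loE node_hiE xk andbT /=.
case: k kmin {xk} kN => [|k] kmin kN; first by rewrite node0.
rewrite leNgt; apply/negP => /ltW xk.
by have := kmin k.+1; rewrite xk ltnn => /(_ isT).
Qed.

(** To the left of its peak a hat function is cut off by its rising line, to
    the right of it by its falling line; these are nonpositive from the
    neighbouring nodes outwards. *)
Lemma hat_off (i : 'I_N) (j : 'I_N.+1) (x : I01 R) :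
  node_lo t i <= (\val x : R) <= node_hi t i ->
  j != lo i -> j != hi i -> hat t j x = 0.
Proof.
rewrite node_loE node_hiE => /andP[xlo xhi] jlo jhi.
have iN := ltn_ord i.
have tj : (\val (t j) : R) = node j by rewrite inord_val.
rewrite /= /hat_fun; apply/max_idPl; rewrite ge_min; apply/orP.
have [ji|ij|ji] := ltngtP j i; last first.
- by case/negP: jlo; apply/eqP/val_inj.
- left; rewrite /hat_rise tj.
  have ij' : (i.+1 < j)%N.
    rewrite ltn_neqAle ij andbT; apply: contraNneq jhi => ij'.
    exact/eqP/val_inj.
  have jN : (j <= N)%N by rewrite -ltnS.
  case: (eqVneq j ord0) => [j0|_]; first by rewrite j0 in ij.
  have le1 : node i.+1 <= node j.-1.
    apply: node_le; case: (nat_of_ord j) ij' jN => //= k.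
    by rewrite ltnS => -> /ltnW ->.
  have lt1 : node j.-1 < node j.
    by apply: node_lt; rewrite jN andbT prednK ?leqnn// (leq_ltn_trans _ ij).
  rewrite mulr_le0_ge0 ?invr_ge0 ?subr_ge0 ?subr_le0 ?(ltW lt1)//.
  exact: le_trans le1.
- right; rewrite /hat_fall tj.
  have jN : (j < N)%N by apply: ltn_trans ji iN.
  case: (eqVneq j ord_max) => [jm|_]; first by move: jN; rewrite jm ltnn.
  have le1 : node j.+1 <= node i by apply: node_le; rewrite ji ltnW.
  have lt1 : node j < node j.+1 by apply: node_lt; rewrite ltnS leqnn.
  rewrite mulr_le0_ge0 ?invr_ge0 ?subr_ge0 ?subr_le0 ?(ltW lt1)//.
  exact: le_trans xlo.
Qed.

(** To the right of its peak, up to the next node, a hat function is its falling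
    line, which is between 0 and 1 there, while the rising line is at least 1;
    [hat_hi] is the mirror image. *)
Lemma hat_lo (i : 'I_N) (x : I01 R) :
  node_lo t i <= (\val x : R) <= node_hi t i ->
  hat t (lo i) x = (node_hi t i - \val x) / (node_hi t i - node_lo t i).
Proof.
have [_ _ /(_ i)] := t_sub; rewrite node_loE node_hiE => lt1 /andP[xlo xhi].
have iN := ltn_ord i.
have tlo : (\val (t (lo i)) : R) = node i by rewrite -node_loE.
rewrite /= /hat_fun /hat_rise /hat_fall tlo /=.
have -> : (lo i == ord_max) = false.
  by apply/negbTE; rewrite -val_eqE /= ltn_eqF.
have fall1 : (node i.+1 - (\val x : R)) / (node i.+1 - node i) <= 1.
  by rewrite ler_pdivrMr ?subr_gt0// mul1r lerD2l lerN2.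
rewrite (_ : Num.min _ _ = (node i.+1 - (\val x : R)) / (node i.+1 - node i)).
  by apply/max_idPr; rewrite divr_ge0 ?subr_ge0// ltW.
apply/min_idPr; apply: le_trans fall1 _.
case: (eqVneq (lo i) ord0) => // i0.
have i_gt0 : (0 < i)%N by rewrite lt0n -[_ == _]/(lo i == ord0).
have lt2 : node i.-1 < node i by apply: node_lt; rewrite prednK// leqnn ltnW.
by rewrite ler_pdivlMr ?subr_gt0// mul1r lerD2r.
Qed.

Lemma hat_hi (i : 'I_N) (x : I01 R) :
  node_lo t i <= (\val x : R) <= node_hi t i ->
  hat t (hi i) x = (\val x - node_lo t i) / (node_hi t i - node_lo t i).
Proof.
have [_ _ /(_ i)] := t_sub; rewrite node_loE node_hiE => lt1 /andP[xlo xhi].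
have iN := ltn_ord i.
have thi : (\val (t (hi i)) : R) = node i.+1 by rewrite -node_hiE.
rewrite /= /hat_fun /hat_rise /hat_fall thi /=.
have rise1 : ((\val x : R) - node i) / (node i.+1 - node i) <= 1.
  by rewrite ler_pdivrMr ?subr_gt0// mul1r lerD2r.
rewrite (_ : Num.min _ _ = ((\val x : R) - node i) / (node i.+1 - node i)).
  by apply/max_idPr; rewrite divr_ge0 ?subr_ge0// ltW.
rewrite /bump /= add1n /=.
apply/min_idPl; apply: le_trans rise1 _.
case: (eqVneq (hi i) ord_max) => // im.
have i1N : (i.+1 < N)%N.
  rewrite ltn_neqAle iN andbT; apply: contraNneq im => im.
  by apply/eqP/val_inj; rewrite /= /bump add1n.
have lt2 : node i.+1 < node i.+2 by apply: node_lt; rewrite leqnn.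
by rewrite ler_pdivlMr ?subr_gt0// mul1r lerD2l lerN2.
Qed.

(** Interpolation freed of hat functions: its node values, its error and the
    bound on its norm are read off this local formula. *)
Lemma pl_interp_cell f (i : 'I_N) (x : I01 R) :
  node_lo t i <= (\val x : R) <= node_hi t i ->
  pl_interp t f x =
    f (t (lo i)) * ((node_hi t i - \val x) / (node_hi t i - node_lo t i)) +
    f (t (hi i)) * ((\val x - node_lo t i) / (node_hi t i - node_lo t i)).
Proof.
move=> xi; rewrite /pl_interp contI_sumE (bigD1 (lo i))//.
rewrite (bigD1 (hi i)); last by rewrite -val_eqE /= /bump add1n gtn_eqF.
rewrite big1 => [|j /andP[jlo jhi]]; last first.
  by rewrite contIZE (hat_off xi)// mulr0.
by rewrite !contIZE (hat_lo xi) (hat_hi xi) /= addr0.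
Qed.

Lemma pl_interp_node f (j : 'I_N.+1) : pl_interp t f (t j) = f (t j).
Proof.
have [_ _ lohi] := t_sub.
have [jN|Nj] := ltnP j N.
  pose i := Ordinal jN; have jlo : t j = t (lo i) by congr t; apply: val_inj.
  have lt1 := lohi i.
  have ne : node_hi t i - node_lo t i != 0 by rewrite subr_eq0 gt_eqF.
  rewrite jlo (@pl_interp_cell _ i); last by rewrite -/(node_lo t i) lexx ltW.
  by rewrite -/(node_lo t i); field.
have [i jhi] : exists i : 'I_N, j = hi i.
  have N0 : (0 < N)%N by have [[i iN] _] := cell_exists (t j); case: (N) iN.
  have iN : (N.-1 < N)%N by rewrite prednK.
  exists (Ordinal iN); apply: val_inj; rewrite /= /bump /= add1n prednK//.
  by apply/eqP; rewrite eqn_leq Nj andbT -ltnS.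
have lt1 := lohi i.
have ne : node_hi t i - node_lo t i != 0 by rewrite subr_eq0 gt_eqF.
rewrite jhi (@pl_interp_cell _ i); last by rewrite -/(node_hi t i) lexx ltW.
by rewrite -/(node_hi t i); field.
Qed.

Lemma pl_interp_pl f : pl_space t (pl_interp t f).
Proof.
move=> i; have [_ _ /(_ i) lt1] := t_sub.
exists ((f (t (hi i)) - f (t (lo i))) / (node_hi t i - node_lo t i)).
exists ((f (t (lo i)) * node_hi t i - f (t (hi i)) * node_lo t i) /
  (node_hi t i - node_lo t i)).
move=> x /pl_interp_cell ->; field; lra.
Qed.

Lemma pl_interp_id v : pl_space t v -> pl_interp t v = v.
Proof.
move=> vpl; apply/contIP => x; have [i xi] := cell_exists x.
have [_ _ /(_ i) lt1] := t_sub.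
rewrite (pl_interp_cell _ xi); have [a [b vE]] := vpl i.
rewrite (vE x)// (vE (t (lo i))) -/(node_lo t i) ?lexx ?ltW//.
rewrite (vE (t (hi i))) -/(node_hi t i) ?lexx ?ltW//.
field; lra.
Qed.

Lemma cell_le_mesh (i : 'I_N) : node_hi t i - node_lo t i <= mesh t.
Proof.
rewrite /mesh (le_trans (ler_norm _))//.
exact: (@le_bigmax_cond _ _ _ _ _ _
  (fun i : 'I_N => `|node_hi t i - node_lo t i|)).
Qed.

(** On each cell the interpolant is a convex combination of the values of f at
    two nodes that are within the mesh size of x. With g = f this gives the
    approximation error, with g = 0 the bound on the norm. *)
Lemma pl_interp_dist f (g : I01 R -> R) (e : R) :
  (forall x z : I01 R, `|\val x - \val z : R| <= mesh t -> `|f z - g x| <= e) ->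
  forall x : I01 R, `|pl_interp t f x - g x| <= e.
Proof.
move=> fg x; have [i xi] := cell_exists x; have /andP[xlo xhi] := xi.
have [_ _ /(_ i) lt1] := t_sub; have mi := cell_le_mesh i.
have flo : `|f (t (lo i)) - g x| <= e.
  apply: fg; rewrite -/(node_lo t i) ger0_norm ?subr_ge0//; lra.
have fhi : `|f (t (hi i)) - g x| <= e.
  apply: fg; rewrite -/(node_hi t i) ler0_norm ?subr_le0//; lra.
rewrite (pl_interp_cell _ xi).
set r := (_ - \val x) / _; set s := (\val x - _) / _.
have r0 : 0 <= r by rewrite divr_ge0 ?subr_ge0 // ltW.
have s0 : 0 <= s by rewrite divr_ge0 ?subr_ge0 // ltW.
have rs : r + s = 1 by rewrite /r /s; field; lra.
have -> : f (t (lo i)) * r + f (t (hi i)) * s - g x =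
    (f (t (lo i)) - g x) * r + (f (t (hi i)) - g x) * s.
  by rewrite -[in LHS](mulr1 (g x)) -rs; ring.
exact: norm_convex_comb_le.
Qed.

Lemma pl_interp_norm f : `|pl_interp t f| <= `|f|.
Proof.
apply: contI_norm_le => x; rewrite -[pl_interp t f x]subr0.
by apply: (@pl_interp_dist f (fun=> 0)) => z w _; rewrite subr0 contI_norm_ge.
Qed.

End interpolation.

Section interpolation_linear.
Variables (R : realType) (N : nat) (t : 'I_N.+1 -> I01 R).
Implicit Types f g : contI R.

Lemma pl_interp_linear (a : R) f g :
  pl_interp t (a *: f + g) = a *: pl_interp t f + pl_interp t g.
Proof.
rewrite /pl_interp scaler_sumr -big_split; apply: eq_bigr => j _.
by rewrite contIDE contIZE scalerDl scalerA.
Qed.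

Lemma pl_interpZ (a : R) f : pl_interp t (a *: f) = a *: pl_interp t f.
Proof.
rewrite /pl_interp scaler_sumr; apply: eq_bigr => j _.
by rewrite contIZE scalerA.
Qed.

Lemma pl_interpB f g : pl_interp t (f - g) = pl_interp t f - pl_interp t g.
Proof. by rewrite addrC -scaleN1r pl_interp_linear scaleN1r addrC. Qed.

Lemma eq_pl_interp f g : (forall j, f (t j) = g (t j)) ->
  pl_interp t f = pl_interp t g.
Proof. by move=> fg; apply: eq_bigr => j _; rewrite fg. Qed.

End interpolation_linear.

Lemma cvg_pl_interp (R : realType) (N : nat) (t : 'I_N.+1 -> I01 R)
    (u_ : nat -> contI R) (u : contI R) :
  is_subdivision t -> u_ @ \oo --> u ->
  pl_interp t (u_ k) @[k --> \oo] --> pl_interp t u.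
Proof.
move=> t_sub u_u; apply/cvgrPdist_lt => e e0; near=> k.
rewrite -pl_interpB (le_lt_trans (pl_interp_norm t_sub _))//.
by near: k; exact: cvgr_dist_lt.
Unshelve. all: by end_near. Qed.

Lemma pl_interp_cvg (R : realType) (t : forall N, 'I_N.+1 -> I01 R)
    (f : contI R) :
  (\forall N \near \oo, is_subdivision (t N)) ->
  mesh (t N) @[N --> \oo] --> (0 : R) ->
  pl_interp (t N) f @[N --> \oo] --> f.
Proof.
move=> t_sub mesh0; apply/cvgrPdist_le => e e0.
have [d d0 fd] := contI_uniformly_continuous f e0.
near=> N; rewrite distrC; apply: contI_norm_le => x.
apply: pl_interp_dist => [|{}x z xz]; first by near: N.
rewrite distrC ltW// fd// (le_lt_trans xz)//.
rewrite (le_lt_trans (ler_norm _))// -[mesh _]subr0 distrC.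
by near: N; exact: cvgr_dist_lt.
Unshelve. all: by end_near. Qed.

(** * Hilbert subspaces and strong convexity of the objective *)

Section hilbert_subspace.
Variables (R : realType) (H : set (contI R)) (dot : contI R -> contI R -> R).
Hypothesis hilbertH : is_hilbert_subspace H dot.
Implicit Types u v w : contI R.

Lemma hilbertZ (a : R) u : H u -> H (a *: u).
Proof.
move=> Hu; rewrite -[_ *: _]addr0.
exact: hilbert_linear hilbertH _ _ _ Hu (hilbert0 hilbertH).
Qed.

Lemma hilbertD u v : H u -> H v -> H (u + v).
Proof.
move=> Hu Hv; rewrite -[u]scale1r.
exact: hilbert_linear hilbertH _ _ _ Hu Hv.
Qed.

Lemma hilbertB u v : H u -> H v -> H (u - v).
Proof.
by move=> Hu Hv; rewrite -scaleN1r; apply: hilbertD => //; exact: hilbertZ.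
Qed.

Lemma hilbert_sum (I : Type) (r : seq I) (F : I -> contI R) :
  (forall i, H (F i)) -> H (\sum_(i <- r) F i).
Proof.
by move=> HF; apply: big_ind => //; [exact: hilbert0 hilbertH|exact: hilbertD].
Qed.

Lemma dot0l v : H v -> dot 0 v = 0.
Proof.
move=> Hv; have H0 := hilbert0 hilbertH.
have := hilbert_dotDl hilbertH 1 H0 H0 Hv.
rewrite scaler0 addr0 mul1r => /eqP.
by rewrite -subr_eq0 opprD addNKr oppr_eq0 => /eqP.
Qed.

Lemma dotZl (a : R) u v : H u -> H v -> dot (a *: u) v = a * dot u v.
Proof.
move=> Hu Hv; rewrite -[_ *: _]addr0.
by rewrite (hilbert_dotDl hilbertH) ?dot0l ?addr0//; exact: hilbert0 hilbertH.
Qed.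

Lemma dotDl u v w : H u -> H v -> H w -> dot (u + v) w = dot u w + dot v w.
Proof.
by move=> Hu Hv Hw; rewrite -[u in LHS]scale1r (hilbert_dotDl hilbertH)// mul1r.
Qed.

Lemma dot_suml (I : Type) (r : seq I) (F : I -> contI R) v :
  (forall i, H (F i)) -> H v ->
  dot (\sum_(i <- r) F i) v = \sum_(i <- r) dot (F i) v.
Proof.
move=> HF Hv; elim: r => [|i r IHr]; first by rewrite !big_nil dot0l.
by rewrite !big_cons dotDl ?IHr//; exact: hilbert_sum.
Qed.

Lemma dot_sqr_linear (a : R) u v : H u -> H v ->
  dot (a *: u + v) (a *: u + v) =
  a ^+ 2 * dot u u + a * dot u v *+ 2 + dot v v.
Proof.
move=> Hu Hv; have Hau := hilbertZ a Hu.
have Hw := hilbertD Hau Hv.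
rewrite dotDl// dotZl//.
rewrite (hilbert_dotC hilbertH Hu Hw) (hilbert_dotC hilbertH Hv Hw).
rewrite !dotDl// !dotZl// (hilbert_dotC hilbertH Hv Hu); ring.
Qed.

Lemma dot_sqrB u v : H u -> H v ->
  dot (u - v) (u - v) = dot u u - dot u v *+ 2 + dot v v.
Proof.
move=> Hu Hv; rewrite addrC -scaleN1r dot_sqr_linear//.
rewrite (hilbert_dotC hilbertH Hv Hu); ring.
Qed.

(** The square norm of a u + v is nonnegative; a = - (u, v) / (u, u) minimizes
    it. *)
Lemma dot_cauchy_schwarz u v : H u -> H v ->
  dot u v ^+ 2 <= dot u u * dot v v.
Proof.
move=> Hu Hv.
have [u0|u0] := eqVneq (dot u u) 0.
  rewrite (hilbert_dot_eq0 hilbertH Hu u0) !dot0l ?mul0r ?expr0n//.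
  exact: hilbert0 hilbertH.
have uu : 0 < dot u u by rewrite lt_neqAle eq_sym u0 (hilbert_dot_ge0 hilbertH).
have := hilbert_dot_ge0 hilbertH
  (hilbert_linear hilbertH (- dot u v / dot u u) Hu Hv).
rewrite dot_sqr_linear//.
have -> : (- dot u v / dot u u) ^+ 2 * dot u u
    + - dot u v / dot u u * dot u v *+ 2 + dot v v =
  (dot u u * dot v v - dot u v ^+ 2) / dot u u by field.
by rewrite pmulr_lge0 ?invr_gt0// subr_ge0.
Qed.

Lemma dot_norm_ge0 u : 0 <= dot_norm dot u.
Proof. exact: sqrtr_ge0. Qed.

Lemma dot_norm_sqr u : H u -> dot_norm dot u ^+ 2 = dot u u.
Proof. by move=> Hu; rewrite sqr_sqrtr// (hilbert_dot_ge0 hilbertH). Qed.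

Lemma dot_norm_distC u v : H u -> H v ->
  dot_norm dot (u - v) = dot_norm dot (v - u).
Proof.
move=> Hu Hv; rewrite /dot_norm !dot_sqrB// (hilbert_dotC hilbertH Hu Hv).
by congr Num.sqrt; ring.
Qed.

Lemma dot_normD u v : H u -> H v ->
  dot_norm dot (u + v) <= dot_norm dot u + dot_norm dot v.
Proof.
move=> Hu Hv; have Huv := hilbertD Hu Hv.
rewrite -(@ler_pXn2r _ 2)// ?nnegrE ?addr_ge0 ?dot_norm_ge0//.
rewrite sqrrD !dot_norm_sqr//.
rewrite -[u in dot (u + v) _]scale1r -[u in dot _ (u + v)]scale1r.
rewrite dot_sqr_linear// expr1n !mul1r lerD2r lerD2l lerMn2r /=.
rewrite (le_trans (ler_norm _))//.
rewrite -(@ler_pXn2r _ 2)// ?nnegrE ?mulr_ge0 ?dot_norm_ge0//.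
rewrite -normrX ger0_norm ?sqr_ge0// exprMn !dot_norm_sqr//.
exact: dot_cauchy_schwarz.
Qed.

Lemma dot_norm_dist u v : H u -> H v ->
  `|dot_norm dot u - dot_norm dot v| <= dot_norm dot (u - v).
Proof.
move=> Hu Hv; rewrite ler_norml; apply/andP; split.
  have := dot_normD (hilbertB Hv Hu) Hu; rewrite subrK dot_norm_distC//; lra.
have := dot_normD (hilbertB Hu Hv) Hv; rewrite subrK; lra.
Qed.

Section objective.
Variables (n : nat) (x : 'I_n -> I01 R) (y : 'I_n -> R) (sigma : R).

Local Notation J := (smoothing_objective dot x y sigma).

(** The parallelogram identity turns the squared norm into the correction term;
    the data term is only used through its convexity. *)
Lemma objective_midpoint u v : H u -> H v ->
  J (2^-1 *: u + 2^-1 *: v) <= (J u + J v) / 2 - dot (u - v) (u - v) / 4.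
Proof.
move=> Hu Hv; have Hm := hilbertD (hilbertZ 2^-1 Hu) (hilbertZ 2^-1 Hv).
rewrite /smoothing_objective !dot_norm_sqr// -scalerDr -[_ *: _]addr0.
have H0 := hilbert0 hilbertH.
have Huv := hilbertD Hu Hv.
rewrite (dot_sqr_linear _ Huv H0) (hilbert_dotC hilbertH Huv H0) !dot0l//.
rewrite -[u in dot (u + v) _]scale1r -[u in dot _ (u + v)]scale1r.
rewrite dot_sqr_linear//.
rewrite dot_sqrB// addr0.
set c := (sigma ^+ 2)^-1; have c0 : 0 <= c by rewrite invr_ge0 sqr_ge0.
set S := \sum_(i < n) _; set Su := \sum_(i < n) _; set Sv := \sum_(i < n) _.
suff : S <= (Su + Sv) / 2 by move=> /(ler_wpM2l c0); lra.
rewrite -big_split /= mulr_suml; apply: ler_sum => i _.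
rewrite contIZE contIDE; have := sqr_ge0 (u (x i) - v (x i)); nra.
Qed.

(** The form in which strong convexity is used: the midpoint hypothesis holds
    whenever u minimizes J over a convex set that contains v. *)
Lemma objective_strongly_convex u v : H u -> H v ->
  J u <= J (2^-1 *: u + 2^-1 *: v) -> dot (u - v) (u - v) <= 2 * (J v - J u).
Proof. by move=> Hu Hv; have := objective_midpoint Hu Hv; lra. Qed.

End objective.

End hilbert_subspace.

Lemma convex_set_midpoint (R : realType) (V : lmodType R)
    (C : set (convex_lmodType V)) (u v : V) :
  convex_set C -> C u -> C v -> C (2^-1 *: u + 2^-1 *: v).
Proof.
move=> Cconv Cu Cv.
have h0 : (0 : R) <= 2^-1 by lra.
have h1 : (2^-1 : R) <= 1 by lra.
have := Cconv u v (Itv01 h0 h1); rewrite !inE => /(_ Cu Cv).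
rewrite [conv _ _ _](_ : _ = 2^-1 *: u + 2^-1 *: v)//.
by congr (_ *: _ + _ *: _); change (1 - 2^-1 = 2^-1 :> R); lra.
Qed.

(** * Minimizers over decreasing convex sets *)

Section nested_minimization.
Variables (R : realType) (H : set (contI R)) (dot : contI R -> contI R -> R).
Hypothesis hilbertH : is_hilbert_subspace H dot.
Variables (n : nat) (x : 'I_n -> I01 R) (y : 'I_n -> R) (sigma : R).

Local Notation J := (smoothing_objective dot x y sigma).

(** The minimal values increase since the sets decrease, and converge since they
    are bounded; strong convexity bounds the distance of two minimizers by the
    difference of their values. *)
Lemma nested_minimizers_cvg (A : nat -> set (contI R)) (h : nat -> contI R)
    (ubJ : R) :
  (forall k, A k `<=` H) ->
  (forall k u v, A k u -> A k v -> A k (2^-1 *: u + 2^-1 *: v)) ->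
  (forall p q, (p <= q)%N -> A q `<=` A p) ->
  (forall k, is_minimizer J (A k) (h k)) ->
  (forall k, J (h k) <= ubJ) ->
  exists2 u, H u & dot_norm dot (h k - u) @[k --> \oo] --> (0 : R).
Proof.
move=> AH Amid Anest hmin Jub.
have Ah k : A k (h k) by have [] := hmin k.
have Hh k : H (h k) by apply: AH (Ah k).
have Jmono : {homo (fun k => J (h k)) : p q / (p <= q)%N >-> p <= q}.
  by move=> p q pq; have [_] := hmin p; apply; apply: Anest pq _ (Ah q).
have Jcvg : cvgn (fun k => J (h k)).
  by apply: (nondecreasing_is_cvgn Jmono); exists ubJ => _ [k _ <-].
have hdist p q : (p <= q)%N ->
    dot_norm dot (h p - h q) ^+ 2 <= 2 * (J (h q) - J (h p)).
  move=> pq; rewrite (dot_norm_sqr hilbertH); last exact: (hilbertB hilbertH).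
  apply: (objective_strongly_convex hilbertH) => //.
  by have [_] := hmin p; apply; apply: Amid => //; apply: Anest pq _ (Ah q).
apply: (hilbert_complete hilbertH) => // e e0.
have e2 : 0 < e ^+ 2 / 4 by rewrite divr_gt0// exprn_gt0.
have [k0 _ Jk0] : \forall k \near \oo,
    `|lim (J (h i) @[i --> \oo]) - J (h k)| < e ^+ 2 / 4.
  exact: cvgr_dist_lt.
set l := lim _ in Jk0.
have Jl k : J (h k) <= l by exact: nondecreasing_cvgn_le Jmono Jcvg k.
have close p q : (k0 <= p)%N -> (p <= q)%N -> dot_norm dot (h p - h q) < e.
  move=> kp pq; rewrite -(@ltr_pXn2r _ 2)// ?nnegrE ?dot_norm_ge0 ?ltW//.
  rewrite (le_lt_trans (hdist _ _ pq))//.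
  have := Jk0 p kp; have := Jl q; have := Jl p.
  move=> ? ?; rewrite /= ger0_norm ?subr_ge0//; lra.
exists k0 => p q kp kq; have [pq|qp] := leqP p q; first exact: close.
by rewrite (dot_norm_distC hilbertH)// close// ltnW.
Qed.

End nested_minimization.

(** * Reproducing kernels and kernel interpolation *)

(** [kf x] is the representer of evaluation at [x], that is, K(., x). *)
Section reproducing_kernel.
Variables (R : realType) (H : set (contI R)) (dot : contI R -> contI R -> R).
Variables (K : I01 R -> I01 R -> R) (kf : I01 R -> contI R).
Hypothesis hilbertH : is_hilbert_subspace H dot.
Hypothesis Hkf : forall x, H (kf x).
Hypothesis kfE : forall x z, kf x z = K z x.
Hypothesis dot_kf : forall x u, H u -> dot u (kf x) = u x.
Implicit Types u v f g : contI R.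

(** Cauchy-Schwarz applied to u(x) = (u, K(., x)), the square norm of K(., x)
    being K(x, x). *)
Lemma rkhs_norm_le (M : R) u : (forall x, K x x <= M) -> H u ->
  `|u| <= Num.sqrt M * dot_norm dot u.
Proof.
move=> KM Hu; apply: contI_norm_le => x.
have Kxx : dot (kf x) (kf x) = K x x by rewrite dot_kf.
have K0 : 0 <= K x x by rewrite -Kxx (hilbert_dot_ge0 hilbertH).
rewrite -(@ler_pXn2r _ 2)// ?nnegrE ?mulr_ge0 ?sqrtr_ge0//.
rewrite -normrX ger0_norm ?sqr_ge0// exprMn (dot_norm_sqr hilbertH Hu).
rewrite sqr_sqrtr ?(le_trans K0)// mulrC -dot_kf//.
apply: le_trans (dot_cauchy_schwarz hilbertH Hu (Hkf x)) _.
by rewrite ler_wpM2l ?(hilbert_dot_ge0 hilbertH)// Kxx.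
Qed.

Lemma rkhs_cvg (M : R) (u_ : nat -> contI R) u :
  (forall x, K x x <= M) -> (forall k, H (u_ k)) -> H u ->
  dot_norm dot (u_ k - u) @[k --> \oo] --> (0 : R) -> u_ @ \oo --> u.
Proof.
move=> KM Hu_ Hu u_u; apply/subr_cvg0/norm_cvg0P.
apply: (@squeeze_cvgr _ _ _ _ (fun=> 0)
  (fun k => Num.sqrt M * dot_norm dot (u_ k - u))).
- near=> k; rewrite normr_ge0 /=; apply: rkhs_norm_le => //.
  exact: (hilbertB hilbertH).
- exact: cvg_cst.
- by rewrite -(mulr0 (Num.sqrt M)); apply: cvgMr.
Unshelve. all: by end_near. Qed.

(** The norm converges by the reverse triangle inequality, the data term because
    convergence in E implies pointwise convergence. *)
Lemma objective_cvg (n : nat) (x : 'I_n -> I01 R) (y : 'I_n -> R) (sigma : R)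
    (u_ : nat -> contI R) u :
  (forall k, H (u_ k)) -> H u ->
  dot_norm dot (u_ k - u) @[k --> \oo] --> (0 : R) -> u_ @ \oo --> u ->
  smoothing_objective dot x y sigma (u_ k) @[k --> \oo] -->
    smoothing_objective dot x y sigma u.
Proof.
move=> Hu_ Hu u_u u_uE.
have norm_cvg : dot_norm dot (u_ k) @[k --> \oo] --> dot_norm dot u.
  apply/subr_cvg0/norm_cvg0P.
  apply: (@squeeze_cvgr _ _ _ _ (fun=> 0)
    (fun k => dot_norm dot (u_ k - u))) => //.
    by near=> k; rewrite normr_ge0 /= (dot_norm_dist hilbertH).
  exact: cvg_cst.
rewrite /smoothing_objective; apply: cvgD; first exact: cvgM.
apply: cvgMr; apply: cvg_big => [|i _].
  exact: add_continuous.
apply: cvgM; apply: cvgB; by [exact: contI_cvg_eval|exact: cvg_cst].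
Unshelve. all: by end_near. Qed.

Section interpolant.
Variables (N : nat) (t : 'I_N.+1 -> I01 R).

Definition kernel_interp f : contI R :=
  \sum_(j < N.+1) (invmx (gram_mx t K) *m node_values t f) j 0 *: kf (t j).

Lemma kernel_interp_mem f : H (kernel_interp f).
Proof. by apply: (hilbert_sum hilbertH) => j; apply: (hilbertZ hilbertH). Qed.

(** By the reproducing property the inner product with an interpolant only
    depends on node values, and is the one of the piecewise linear space. *)
Lemma dot_kernel_interp f u : H u ->
  dot (kernel_interp f) u =
    ((node_values t u)^T *m invmx (gram_mx t K) *m node_values t f) 0 0.
Proof.
move=> Hu; rewrite /kernel_interp (dot_suml hilbertH)// => [|j]; last first.
  exact: (hilbertZ hilbertH).
rewrite -mulmxA mxE; apply: eq_bigr => j _.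
by rewrite (dotZl hilbertH)// (hilbert_dotC hilbertH)// dot_kf// !mxE mulrC.
Qed.

Lemma eq_kernel_interp f g : (forall j, f (t j) = g (t j)) ->
  kernel_interp f = kernel_interp g.
Proof.
move=> fg; rewrite /kernel_interp (_ : node_values t f = node_values t g)//.
by apply/colP => j; rewrite !mxE.
Qed.

Hypothesis gram_unit : gram_mx t K \in unitmx.

Lemma kernel_interp_node f (i : 'I_N.+1) : kernel_interp f (t i) = f (t i).
Proof.
have /colP/(_ i) := mulKVmx gram_unit (node_values t f); rewrite !mxE => <-.
rewrite contI_sumE; apply: eq_bigr => j _.
by rewrite contIZE kfE [RHS]mulrC !mxE.
Qed.

Lemma node_values_kernel_interp f :
  node_values t (kernel_interp f) = node_values t f.
Proof. by apply/colP => i; rewrite !mxE kernel_interp_node. Qed.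

Lemma dot_norm_kernel_interp f :
  dot_norm (pl_dot t K) f = dot_norm dot (kernel_interp f).
Proof.
rewrite /dot_norm dot_kernel_interp; last exact: kernel_interp_mem.
by rewrite node_values_kernel_interp.
Qed.

(** [dot_kernel_interp] shows that u - I u is orthogonal to I u. *)
Lemma kernel_interp_min u : H u ->
  dot (kernel_interp u) (kernel_interp u) <= dot u u.
Proof.
move=> Hu; have Hi := kernel_interp_mem u.
have := hilbert_dot_ge0 hilbertH (hilbertB hilbertH Hu Hi).
rewrite (dot_sqrB hilbertH)// (hilbert_dotC hilbertH Hu Hi).
suff -> : dot (kernel_interp u) u = dot (kernel_interp u) (kernel_interp u).
  by lra.
by rewrite !dot_kernel_interp// node_values_kernel_interp.
Qed.

Variables (n : nat) (x : 'I_n -> I01 R) (y : 'I_n -> R) (sigma : R).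
Hypothesis data_nodes : range x `<=` range t.

Lemma objective_kernel_interp f :
  smoothing_objective (pl_dot t K) x y sigma f =
  smoothing_objective dot x y sigma (kernel_interp f).
Proof.
rewrite /smoothing_objective dot_norm_kernel_interp; congr (_ + _ * _).
apply: eq_bigr => i _.
have [j _ <-] : range t (x i) by apply: data_nodes; exists i.
by rewrite kernel_interp_node.
Qed.

Lemma objective_kernel_interp_le u : H u ->
  smoothing_objective dot x y sigma (kernel_interp u) <=
  smoothing_objective dot x y sigma u.
Proof.
move=> Hu; have Hi := kernel_interp_mem u.
rewrite /smoothing_objective !(dot_norm_sqr hilbertH)//.
apply: lerD; first exact: kernel_interp_min.
rewrite le_eqVlt; apply/orP; left; apply/eqP; congr (_ * _).
apply: eq_bigr => i _.
have [j _ <-] : range t (x i) by apply: data_nodes; exists i.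
by rewrite kernel_interp_node.
Qed.

End interpolant.
End reproducing_kernel.

(** * Convergence of the discrete minimizers *)

Theorem theorem4p3 (R : realType)
    (H : set (contI R)) (dotH : contI R -> contI R -> R)
    (K : I01 R -> I01 R -> R) (C : set (contI R))
    (n : nat) (x : 'I_n -> I01 R) (y : 'I_n -> R) (sigma : R)
    (N0 : nat) (t : forall N : nat, 'I_N.+1 -> I01 R)
    (uhat : contI R) (uhat_ : nat -> contI R)
    (hK : is_spd_kernel K)
    (hH : is_rkhs H dotH K)
    (hKbound : has_ubound (range (fun z : I01 R => K z z)))
    (hCclosed : closed C)
    (hCconvex : convex_set C)
    (hsigma : 0 < sigma)
    (ht : forall N : nat, (N0 <= N)%N -> is_subdivision (t N))
    (hmesh : mesh (t N) @[N --> \oo] --> (0 : R))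
    (hHC : H `&` C !=set0)
    (hnested : forall N : nat, (N0 <= N)%N ->
       range (t N) `<=` range (t N.+1))
    (hdata : forall N : nat, (N0 <= N)%N -> range x `<=` range (t N))
    (hinterp : forall N : nat, (N0 <= N)%N -> pl_interp (t N) @` C `<=` C)
    (hgram : forall N : nat, (N0 <= N)%N -> gram_mx (t N) K \in unitmx)
    (huhat : is_minimizer (smoothing_objective dotH x y sigma)
       (H `&` C) uhat)
    (huhat_ : forall N : nat, (N0 <= N)%N ->
       is_minimizer (smoothing_objective (pl_dot (t N) K) x y sigma)
         (pl_space (t N) `&` C) (uhat_ N)) :
  uhat_ @ \oo --> uhat.
Proof.
have [hilbertH reproducing] := hH.
have [kf kfP] := choice reproducing.
have Hkf z : H (kf z) by have [] := kfP z.
have kfE z w : kf z w = K w z by have [_ ->] := kfP z.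
have dot_kf z u : H u -> dotH u (kf z) = u z.
  by have [_ _ kfz] := kfP z => /kfz ->.
have [M KM] := hKbound.
have KleM z : K z z <= M by apply: KM; exists z.
pose J := smoothing_objective dotH x y sigma.
(* The constraint is imposed on the interpolant of u, not on u: this relaxes
   membership in C, and is what uhat_ N controls. *)
pose A N := [set u | H u /\ C (pl_interp (t N) u)].
pose h N := kernel_interp K kf (t N) (uhat_ N).
have Hh N : H (h N) by exact: (kernel_interp_mem K hilbertH Hkf).
have t_mono p q : (N0 <= p)%N -> (p <= q)%N -> range (t p) `<=` range (t q).
  move=> Np; elim: q => [|q IHq]; first by rewrite leqn0 => /eqP ->.
  rewrite leq_eqVlt => /predU1P[-> //|pq].
  exact: subset_trans (IHq pq) (hnested _ (leq_trans Np pq)).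
have AC N : (N0 <= N)%N -> forall u, (H `&` C) u -> A N u.
  by move=> NN u [Hu Cu]; split => //; apply: (hinterp _ NN); exists u.
have Amid N u v : A N u -> A N v -> A N (2^-1 *: u + 2^-1 *: v).
  move=> [Hu Cu] [Hv Cv]; split.
    by apply: (hilbertD hilbertH); exact: (hilbertZ hilbertH).
  by rewrite pl_interp_linear pl_interpZ; exact: convex_set_midpoint.
have Anest p q : (N0 <= p)%N -> (p <= q)%N -> A q `<=` A p.
  move=> Np pq u [Hu Cu]; split=> //.
  have Nq := leq_trans Np pq.
  rewrite -(@eq_pl_interp _ _ _ (pl_interp (t q) u)).
    by apply: (hinterp _ Np); exists (pl_interp (t q) u).
  move=> j; have [i _ <-] : range (t q) (t p j).
    by apply: (t_mono _ _ Np pq); exists j.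
  by rewrite pl_interp_node//; exact: ht.
have interp_h N : (N0 <= N)%N -> pl_interp (t N) (h N) = uhat_ N.
  move=> NN; have [[uhat_pl _] _] := huhat_ _ NN.
  rewrite -[RHS](pl_interp_id (ht _ NN))//; apply: eq_pl_interp => j.
  exact: (kernel_interp_node kfE (hgram _ NN)).
have hmin N : (N0 <= N)%N -> is_minimizer J (A N) (h N).
  move=> NN; have [[_ Cuhat_] uhat_min] := huhat_ _ NN; split.
    by split => //; rewrite interp_h.
  move=> u [Hu Cu].
  have objE := objective_kernel_interp hilbertH Hkf kfE dot_kf (hgram _ NN)
    y sigma (hdata _ NN).
  rewrite /J -objE.
  apply: le_trans (objective_kernel_interp_le hilbertH Hkf kfE dot_kf
    (hgram _ NN) y sigma (hdata _ NN) Hu).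
  rewrite (@eq_kernel_interp _ _ _ _ _ u (pl_interp (t N) u)) => [|j].
  2: by rewrite (pl_interp_node (ht _ NN)).
  rewrite -objE; apply: uhat_min; split=> //; exact: (pl_interp_pl (ht _ NN)).
have [HCuhat uhat_min] := huhat.
have [Huhat Cuhat] := HCuhat.
have NN k : (N0 <= k + N0)%N by exact: leq_addl.
have hJ k : J (h (k + N0)%N) <= J uhat.
  by have [_] := hmin _ (NN k); apply; exact: AC.
(* Shift by N0, as the hypotheses hold from N0 onwards only. *)
have [u Hu h_u] : exists2 u, H u &
    dot_norm dotH (h (k + N0)%N - u) @[k --> \oo] --> (0 : R).
  apply: (nested_minimizers_cvg hilbertH
    (A := fun k => A (k + N0)%N) _ _ _ _ hJ).
  - by move=> k v [].
  - by move=> k; exact: Amid.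
  - by move=> p q pq; apply: Anest; rewrite ?leq_add2r.
  - by move=> k; exact: hmin.
have h_uE : h (k + N0)%N @[k --> \oo] --> u.
  exact: (rkhs_cvg hilbertH Hkf kfE dot_kf KleM
    (fun k => Hh (k + N0)%N) Hu h_u).
have t_sub : \forall N \near \oo, is_subdivision (t N) by exists N0.
have Cpi N : (N0 <= N)%N -> C (pl_interp (t N) u).
  move=> N0N; have pi_h := cvg_pl_interp (ht _ N0N) h_uE.
  apply: (closed_cvg _ hCclosed) pi_h; exists N => // k /= Nk.
  have [] // : A N (h (k + N0)%N).
  apply: (Anest _ (k + N0)%N) => //; first by rewrite (leq_trans Nk)// leq_addr.
  by have [] := hmin _ (NN k).
have Cu : C u.
  have pi_u := @pl_interp_cvg _ _ u t_sub hmesh.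
  by apply: (closed_cvg _ hCclosed) pi_u; exists N0.
have Ju : J u <= J uhat.
  have J_u := @objective_cvg _ _ _ hilbertH _ x y sigma _ _
    (fun k => Hh (k + N0)%N) Hu h_u h_uE.
  apply: (closed_cvg _ (@closed_le R (J uhat))) J_u.
  by near=> k; exact: hJ.
(* Both u and uhat minimize J over the convex set H `&` C, so that strong
   convexity makes them equal. *)
have u_uhat : u = uhat.
  apply/eqP; rewrite -subr_eq0; apply/eqP; apply: (hilbert_dot_eq0 hilbertH).
    exact: (hilbertB hilbertH).
  apply/eqP; rewrite eq_le (hilbert_dot_ge0 hilbertH) ?andbT; last first.
    exact: (hilbertB hilbertH).
  have Jmid : J u <= J (2^-1 *: u + 2^-1 *: uhat).
    apply: le_trans Ju (uhat_min _ _); split; last exact: convex_set_midpoint.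
    by apply: (hilbertD hilbertH); exact: (hilbertZ hilbertH).
  have := objective_strongly_convex hilbertH Hu Huhat Jmid.
  have := uhat_min u (conj Hu Cu); rewrite -/J; lra.
rewrite u_uhat in h_uE.
have pi_h_u : pl_interp (t (k + N0)%N) (h (k + N0)%N - uhat) @[k --> \oo]
    --> (0 : contI R).
  apply/norm_cvg0P.
  apply: (@squeeze_cvgr _ _ _ _ (fun=> 0) (fun k => `|h (k + N0)%N - uhat|)).
  - near=> k; apply/andP; split; first exact: normr_ge0.
    exact: (pl_interp_norm (ht _ (NN k))).
  - exact: cvg_cst.
  - by apply/norm_cvg0P/subr_cvg0.
have pi_u : pl_interp (t (k + N0)%N) uhat @[k --> \oo] --> uhat.
  by have := @pl_interp_cvg _ _ uhat t_sub hmesh; rewrite -(cvg_shiftn N0).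
rewrite -(cvg_shiftn N0).
have -> : [sequence uhat_ (k + N0)%N]_k = fun k =>
    pl_interp (t (k + N0)%N) (h (k + N0)%N - uhat) +
    pl_interp (t (k + N0)%N) uhat.
  by apply/funext => k; rewrite pl_interpB subrK interp_h.
have := cvgD pi_h_u pi_u; rewrite (add0r uhat); exact.
Unshelve. all: by end_near. Qed.
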